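(* Let $\mathbb{T}$ be an equivalence on the category of frames, and let $L$ and $K$ be frames. Then the map $\mathbb{T}:\mathrm{Arr}\langle L,K\rangle\to\mathrm{Arr}\langle\mathbb{T}L,\mathbb{T}K\rangle$, $f\mapsto\mathbb{T}f$, preserves order; that is, if $f\leq g$ in $\mathrm{Arr}\langle L,K\rangle$ then $\mathbb{T}f\leq\mathbb{T}g$ in $\mathrm{Arr}\langle\mathbb{T}L,\mathbb{T}K\rangle$.
   Context: A frame is a complete lattice satisfying $a\wedge\bigvee_{i\in I}b_i=\bigvee_{i\in I}(a\wedge b_i)$. The arrows of the category of frames are the functions preserving finite meets (including the top element $1$) and arbitrary joins (including the bottom element $0$). $\mathrm{Arr}\langle A,B\rangle$ denotes the set of arrows of the category of frames with source $A$ and target $B$, with the pointwise partial order: $f\leq g$ iff $f(x)\leq g(x)$ for all $x\in A$. An equivalence on a category $\mathcal{C}$ is a functor $\mathcal{C}\to\mathcal{C}$ which is full and faithful and has a full and faithful left adjoint. *)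

(* Defs.v *)
From mathcomp Require Import all_boot.
From mathcomp Require Import boolp classical_sets.

Set Implicit Arguments.
Unset Strict Implicit.
Unset Printing Implicit Defensive.

Local Open Scope classical_set_scope.

(** * Categories, functors, equivalences *)

Record category := Category {
  obj :> Type;
  hom : obj -> obj -> Type;
  idm : forall A, hom A A;
  comp : forall A B C, hom B C -> hom A B -> hom A C;
  comp_idl : forall A B (f : hom A B), comp (idm B) f = f;
  comp_idr : forall A B (f : hom A B), comp f (idm A) = f;
  comp_assoc : forall A B C D (h : hom C D) (g : hom B C) (f : hom A B),
    comp h (comp g f) = comp (comp h g) f
}.

Arguments hom {c} A B.
Arguments idm {c} A.
Arguments comp {c A B C} g f.

Record functor (C D : category) := Functor {
  fobj :> C -> D;
  fmap : forall A B : C, hom A B -> hom (fobj A) (fobj B);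
  fmap_id : forall A : C, fmap (idm A) = idm (fobj A);
  fmap_comp : forall (A B E : C) (g : hom B E) (f : hom A B),
    fmap (comp g f) = comp (fmap g) (fmap f)
}.

Arguments fmap {C D} F {A B} f : rename.

Definition faithful (C D : category) (F : functor C D) : Prop :=
  forall (A B : C) (f g : hom A B), fmap F f = fmap F g -> f = g.

Definition full (C D : category) (F : functor C D) : Prop :=
  forall (A B : C) (h : hom (F A) (F B)), exists f : hom A B, fmap F f = h.

(** [adjunction G F]: [G] is left adjoint to [F]. *)
Record adjunction (C D : category) (G : functor D C) (F : functor C D) :=
  Adjunction {
  adj : forall (X : D) (A : C), hom (G X) A -> hom X (F A);
  adj_bij : forall (X : D) (A : C), bijective (@adj X A);
  adj_nat : forall (X X' : D) (A A' : C)
      (u : hom X' X) (v : hom A A') (k : hom (G X) A),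
    adj (comp v (comp k (fmap G u))) = comp (fmap F v) (comp (adj k) u)
}.

Definition is_equivalence (C : category) (T : functor C C) : Prop :=
  [/\ full T, faithful T &
      exists G : functor C C,
        [/\ inhabited (adjunction G T), full G & faithful G]].

(** * Frames *)

(** MathComp's order structures carry a choice operator and a boolean order
    relation, which are not part of the data of a frame; hence this record on
    a bare type. *)
Record complete_lattice := CompleteLattice {
  carrier :> Type;
  le : carrier -> carrier -> Prop;
  le_refl : forall x, le x x;
  le_trans : forall y x z, le x y -> le y z -> le x z;
  le_anti : forall x y, le x y -> le y x -> x = y;
  Join : set carrier -> carrier;
  Join_ub : forall (S : set carrier) x, S x -> le x (Join S);
  Join_le : forall (S : set carrier) y,
    (forall x, S x -> le x y) -> le (Join S) y;
  Meet : set carrier -> carrier;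
  Meet_lb : forall (S : set carrier) x, S x -> le (Meet S) x;
  le_Meet : forall (S : set carrier) y,
    (forall x, S x -> le y x) -> le y (Meet S)
}.

Arguments le {c} x y.
Arguments Join {c} S.
Arguments Meet {c} S.

Definition meet (A : complete_lattice) (x y : A) : A := Meet [set x; y].
Definition top (A : complete_lattice) : A := Meet set0.
Arguments top {A}.

(** Families are represented by their sets of values, so the frame law is
    quantified over subsets. *)
Record frame := Frame {
  frame_lattice :> complete_lattice;
  frame_law : forall (a : frame_lattice) (S : set frame_lattice),
    meet a (Join S) = Join [set meet a b | b in S]
}.

(** Preservation of the bottom element is the case [S = set0] of
    [arr_Join]. *)
Record frame_arrow (A B : frame) := FrameArrow {
  arr_fun :> A -> B;
  arr_top : arr_fun top = top;
  arr_meet : forall x y : A, arr_fun (meet x y) = meet (arr_fun x) (arr_fun y);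
  arr_Join : forall S : set A, arr_fun (Join S) = Join (arr_fun @` S)
}.

Lemma frame_arrow_eq (A B : frame) (f g : frame_arrow A B) :
  (forall x, f x = g x) -> f = g.
Proof.
case: f => f f1 f2 f3; case: g => g g1 g2 g3 /= fg.
have e : f = g by apply: funext.
by subst g; congr FrameArrow; exact: Prop_irrelevance.
Qed.

Definition frame_id (A : frame) : frame_arrow A A.
Proof.
by refine (@FrameArrow A A (fun x => x) _ _ _) => // S; rewrite image_id.
Defined.

Definition frame_comp (A B C : frame) (g : frame_arrow B C)
  (f : frame_arrow A B) : frame_arrow A C.
Proof.
refine (@FrameArrow A C (fun x => g (f x)) _ _ _).
- by rewrite !arr_top.
- by move=> x y; rewrite !arr_meet.
- by move=> S; rewrite !arr_Join image_comp.
Defined.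

Definition Frm : category.
Proof.
refine (@Category frame frame_arrow frame_id frame_comp _ _ _).
- by move=> A B f; apply: frame_arrow_eq.
- by move=> A B f; apply: frame_arrow_eq.
- by move=> A B C D h g f; apply: frame_arrow_eq.
Defined.

Definition arrow_le (A B : frame) (f g : frame_arrow A B) : Prop :=
  forall x : A, le (f x) (g x).

(* Main.v *)
From mathcomp Require Import all_boot.
From mathcomp Require Import boolp classical_sets.
Require Import Defs.

Set Implicit Arguments.
Unset Strict Implicit.
Unset Printing Implicit Defensive.

Local Open Scope classical_set_scope.

(** Why the theorem holds.  Let 3 be the Sierpinski frame, the chain with three
elements and free frame on one generator [gen]: the elements of a frame [A]
are the arrows from 3 to [A].

An equivalence [T] preserves 3.  Indeed, the identity of 3 differs from an
endomorphism with image {0, 1}, and this difference is seen by an element of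
[T 3] other than 0 and 1; on the other hand, moving the question along an
isomorphism of 3 with some [T M] makes [T 3] a retract of 3 ([on_sierp_iso]).
So there is a free generator [t] of [T 3], and sending an element [x] of [A],
seen as an arrow from 3 to [A], to the image of [t] under [T x] is a bijection
from [A] to [T A], natural in [A] ([lift]).  It remains to see that these
bijections preserve order, for then [T f] and [T g] are, up to them, [f] and
[g].

Let us look first at [A = 3].  As the bijection sends [gen] to [t], it either
fixes 0 and 1 or exchanges them.  An exchange is what an order-reversing
equivalence would do, such as duality on distributive lattices; frames exclude
it because arrows preserve joins, and need not preserve infinite meets
([lift_top_neq_bot]).  Hence the bijection of 3 with [T 3] is monotone.

Monotonicity passes to every frame that has enough arrows to 3, by naturality
([lift_lower_le]).  An arbitrary frame [A] need not have enough of them, but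
each inequality of [A] is the image of an inequality in the frame of lower sets
of a linear order ([nat_desc_le]), which has enough. *)

(** * Equivalences of categories *)

(** The unit of the adjunction is the isomorphism.  Its inverse [r] is the arrow
that the left adjoint [G] sends to the counit at [G X]. *)
Lemma equivalence_ess_surj (C : category) (T : functor C C) (X : C) :
  is_equivalence T ->
  exists (A : C) (e : hom X (T A)) (r : hom (T A) X),
    comp e r = idm (T A) /\ comp r e = idm X.
Proof.
case=> _ _ [G [[[ad ad_bij ad_nat]] Gfull Gfaith]].
have adG Y (u : hom Y X) : ad _ _ (fmap G u) = comp (ad _ _ (idm (G X))) u.
  have := ad_nat X Y (G X) (G X) u (idm (G X)) (idm (G X)).
  by rewrite fmap_id !comp_idl.
have [ev adK evK] := ad_bij (T (G X)) (G X).
have [r Gr] := Gfull _ _ (ev (idm (T (G X)))).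
have er : comp (ad _ _ (idm (G X))) r = idm (T (G X)) by rewrite -adG Gr evK.
exists (G X), (ad _ _ (idm (G X))), r; split=> //.
apply: Gfaith; apply: (bij_inj (ad_bij X (G X))).
by rewrite adG comp_assoc er comp_idl fmap_id.
Qed.

(** * Order in frames *)

Definition bot (A : complete_lattice) : A := Join set0.
Arguments bot {A}.

Lemma bot_le (A : complete_lattice) (x : A) : le bot x.
Proof. exact: Join_le. Qed.

Lemma le_top (A : complete_lattice) (x : A) : le x top.
Proof. exact: le_Meet. Qed.

Lemma meet_lel (A : complete_lattice) (x y : A) : le (meet x y) x.
Proof. by apply: Meet_lb; left. Qed.

Lemma meet_ler (A : complete_lattice) (x y : A) : le (meet x y) y.
Proof. by apply: Meet_lb; right. Qed.

Lemma le_meet (A : complete_lattice) (x y z : A) :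
  le z x -> le z y -> le z (meet x y).
Proof. by move=> zx zy; apply: le_Meet => w [] ->. Qed.

Lemma meetC (A : complete_lattice) (x y : A) : meet x y = meet y x.
Proof. by apply: le_anti; apply: le_meet; auto using meet_lel, meet_ler. Qed.

Lemma le_meetP (A : complete_lattice) (x y : A) : le x y <-> meet x y = x.
Proof.
split=> [xy|<-]; last exact: meet_ler.
by apply: le_anti; [exact: meet_lel | apply: le_meet => //; exact: le_refl].
Qed.

Lemma frame_compE (A B C : frame) (g : frame_arrow B C) (f : frame_arrow A B)
  (x : A) : frame_comp g f x = g (f x).
Proof. by []. Qed.

Lemma arr_bot (A B : frame) (f : frame_arrow A B) : f bot = bot.
Proof. by rewrite /bot arr_Join image_set0. Qed.

Lemma arr_le (A B : frame) (f : frame_arrow A B) (x y : A) :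
  le x y -> le (f x) (f y).
Proof. by move=> /le_meetP xy; apply/le_meetP; rewrite -arr_meet xy. Qed.

(** * Frames of lower sets *)

Section LowerSets.
Context (P : Type) (r : P -> P -> Prop).

Definition lower := {S : set P | forall p q, r p q -> S q -> S p}.

Lemma lower_eq (S U : lower) : (forall p, sval S p <-> sval U p) -> S = U.
Proof.
case: S => S Slow; case: U => U Ulow /= SU.
have e : S = U by apply/funext => p; apply/propext.
by subst U; congr exist; exact: Prop_irrelevance.
Qed.

Definition lower_Join (F : set lower) : lower.
Proof.
exists (fun p => exists2 S, F S & sval S p) => p q pq [S FS Sq].
by exists S => //; exact: (svalP S) pq Sq.
Defined.

Definition lower_Meet (F : set lower) : lower.
Proof.
exists (fun p => forall S, F S -> sval S p) => p q pq Fq S FS.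
exact: (svalP S) pq (Fq S FS).
Defined.

Definition lower_lattice : complete_lattice.
Proof.
refine (@CompleteLattice lower (fun S U => forall p, sval S p -> sval U p)
  _ _ _ lower_Join _ _ lower_Meet _ _) => //=.
- by move=> U S V SU UV p /SU /UV.
- by move=> S U SU US; apply: lower_eq => p; split; [exact: SU | exact: US].
- by move=> F S FS p Sp; exists S.
- by move=> F U FU p [S FS Sp]; exact: FU FS p Sp.
- by move=> F S FS p; exact.
- by move=> F U FU p Up S FS; exact: FU FS p Up.
Defined.

Lemma sval_lower_meet (S U : lower_lattice) p :
  sval (meet S U) p <-> sval S p /\ sval U p.
Proof.
split=> [SUp|[Sp Up] V [] -> //].
by split; apply: SUp; [left | right].
Qed.

Definition lower_frame : frame.
Proof.
exists lower_lattice => S F; apply: lower_eq => p; split.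
  move=> /sval_lower_meet[Sp [U FU Up]].
  by exists (meet S U); [exists U | apply/sval_lower_meet].
move=> [_ [U FU <-] /sval_lower_meet[Sp Up]].
by apply/sval_lower_meet; split=> //; exists U.
Defined.

(** If [p] is in one lower set and [q] in another, the lesser of [p] and [q] is in
both, and the value of [x] there is above the meet of [x p] and [x q].  By the
frame law this is what the preservation of binary meets amounts to. *)
Definition lower_ext (A : frame) (x : P -> A)
  (r_total : forall p q, r p q \/ r q p)
  (x_cover : Join (range x) = top) : frame_arrow lower_frame A.
Proof.
refine (@FrameArrow lower_frame A (fun S => Join (x @` sval S)) _ _ _).
- rewrite -x_cover; congr Join; apply/seteqP; split=> _ [p _ <-];
    by exists p.
- move=> S U; apply: le_anti.
    by apply: le_meet; apply: Join_le => _ [p /sval_lower_meet[Sp Up] <-];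
      apply: Join_ub; exists p.
  rewrite frame_law; apply: Join_le => _ [_ [q Uq <-] <-].
  rewrite meetC frame_law; apply: Join_le => _ [_ [p Sp <-] <-].
  have [pq|qp] := r_total p q.
    apply: le_trans (meet_ler _ _) _; apply: Join_ub; exists p => //.
    by apply/sval_lower_meet; split=> //; exact: (svalP U) pq Uq.
  apply: le_trans (meet_lel _ _) _; apply: Join_ub; exists q => //.
  by apply/sval_lower_meet; split=> //; exact: (svalP S) qp Sp.
- move=> F; apply: le_anti; apply: Join_le.
    move=> _ [p [S FS Sp] <-].
    apply: (@le_trans _ (Join (x @` sval S))).
      by apply: Join_ub; exists p.
    by apply: Join_ub; exists S.
  move=> _ [S FS <-]; apply: Join_le => _ [p Sp <-].
  by apply: Join_ub; exists p => //; exists S.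
Defined.

End LowerSets.

Lemma lower_extE (P : Type) (r : P -> P -> Prop) (A : frame) (x : P -> A)
    r_total x_cover (S : lower_frame r) (p : P) :
  sval S p -> (forall q, sval S q -> le (x q) (x p)) ->
  @lower_ext P r A x r_total x_cover S = x p.
Proof.
move=> Sp px; apply: le_anti; last by apply: Join_ub; exists p.
by apply: Join_le => _ [q Sq <-]; exact: px.
Qed.

(** * The Sierpinski frame *)

Definition sierp : frame := lower_frame (fun b c : bool => b ==> c).

(** The lower set of [false] alone, strictly between [bot] and [top]. *)
Definition gen : sierp.
Proof. by exists (fun b : bool => ~~ b) => -[] []. Defined.

Lemma sierpP (x : sierp) : [\/ x = bot, x = gen | x = top].
Proof.
have xm : sval x true -> sval x false by apply: (svalP x).
have [xt|xt] := pselect (sval x true).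
  by constructor 3; apply: lower_eq => b; split=> // _; case: b; auto.
have [xf|xf] := pselect (sval x false).
  by constructor 2; apply: lower_eq => -[]; split.
by constructor 1; apply: lower_eq => -[]; split=> // -[].
Qed.

Lemma sierp_le (x y : sierp) : le x y -> [\/ x = bot, y = top | x = y].
Proof.
have [->|->|->] := sierpP x; first by constructor 1.
  have [->|->|->] := sierpP y; [|by constructor 3|by constructor 2].
  by move=> /(_ false isT) [].
move=> ty; constructor 2; apply: le_anti ty; exact: le_top.
Qed.

Lemma gen_neq_bot : gen <> bot.
Proof. by move=> e; have : sval gen false by []; rewrite e => -[]. Qed.

Lemma gen_neq_top : gen <> top.
Proof.
by move=> e; have : sval (top : sierp) true by []; rewrite -e.
Qed.

Lemma sierp_bot_neq_top : (bot : sierp) <> top.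
Proof.
by move=> e; have : sval (top : sierp) true by []; rewrite -e => -[].
Qed.

Definition classify (A : frame) (x : A) : frame_arrow sierp A.
Proof.
refine (@lower_ext bool _ A (fun b => if b then top else x) _ _).
- by move=> [] []; auto.
- by apply: le_anti; [exact: le_top | apply: Join_ub; exists true].
Defined.

Lemma classify_gen (A : frame) (x : A) : classify x gen = x.
Proof.
rewrite /classify (@lower_extE _ _ _ _ _ _ _ false) // => -[] // _.
exact: le_refl.
Qed.

Lemma sierp_arr_eq (A : frame) (f g : frame_arrow sierp A) :
  f gen = g gen -> f = g.
Proof.
move=> fg; apply: frame_arrow_eq => x.
by have [->|->|->] := sierpP x; rewrite ?arr_bot ?arr_top.
Qed.

Lemma arr_classify (A B : frame) (f : frame_arrow A B) (x : A) (s : sierp) :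
  f (classify x s) = classify (f x) s.
Proof.
rewrite -[LHS]/(frame_comp f (classify x) s); congr (arr_fun _ s).
by apply: sierp_arr_eq; rewrite frame_compE !classify_gen.
Qed.

Lemma classify_gen_id (s : sierp) : classify gen s = s.
Proof.
rewrite -[RHS]/(frame_id sierp s); congr (arr_fun _ s).
by apply: sierp_arr_eq; rewrite classify_gen.
Qed.

(** * Arrows to the Sierpinski frame *)

Definition truth (Q : Prop) : sierp.
Proof. by exists (fun=> Q). Defined.

Definition lower_pt (P : Type) (r : P -> P -> Prop) (p : P) :
  frame_arrow (lower_frame r) sierp.
Proof.
refine (@FrameArrow (lower_frame r) sierp
  (fun S => truth (sval S p)) _ _ _).
- by apply: lower_eq => b; split=> _ S [].
- move=> S U; apply: lower_eq => b; split.
    by move=> /sval_lower_meet SUp; apply/sval_lower_meet.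
  by move=> /sval_lower_meet SUp; apply/sval_lower_meet.
- move=> F; apply: lower_eq => b; split.
    by move=> [S FS Sp]; eexists; [exists S|].
  by move=> [_ [S FS <-] Sp]; exists S.
Defined.

Lemma lower_ptP (P : Type) (r : P -> P -> Prop) (p : P) (S : lower_frame r) :
  sval S p <-> lower_pt r p S = top.
Proof.
split=> [Sp|e]; first by apply: lower_eq => b; split=> // _ U [].
by have : sval (top : sierp) true by []; rewrite -e.
Qed.

(** Frames of lower sets are spatial; their points are taken here with values in
the Sierpinski frame rather than in the initial frame, so that only the former
has to be followed along an equivalence. *)
Lemma lower_pt_sep (P : Type) (r : P -> P -> Prop) (S U : lower_frame r) :
  (forall p, lower_pt r p S = lower_pt r p U) -> S = U.
Proof.
by move=> SU; apply: lower_eq => p; split=> /lower_ptP e; apply/lower_ptP;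
  rewrite -e SU.
Qed.

(** * A chain with a non-trivial infinite meet *)

(** Lower sets of the natural numbers with the order reversed: the chain of the
final segments [tail n], decreasing in [n], above their meet [bot]. *)
Definition nat_desc : frame := lower_frame (fun m n : nat => n <= m).

Definition tail (n : nat) : nat_desc.
Proof.
by exists (fun m : nat => n <= m) => p q qp nq; exact: leq_trans qp.
Defined.

Lemma nat_desc_total (m n : nat) : n <= m \/ m <= n.
Proof. by apply/orP; rewrite leq_total. Qed.

(** Extend the sequence [top], [y], [x], [x], ... along the final segments. *)
Lemma nat_desc_le (A : frame) (x y : A) : le x y ->
  exists h : frame_arrow nat_desc A, h (tail 2) = x /\ h (tail 1) = y.
Proof.
move=> xy.
pose s (n : nat) := if n is n'.+1 then if n' is 0 then y else x else top.
have s_cover : Join (range s) = top.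
  by apply: le_anti; [exact: le_top | apply: Join_ub; exists 0].
exists (lower_ext nat_desc_total s_cover); split.
  by rewrite (@lower_extE _ _ _ _ _ _ _ 2) // => -[|[|q]] // _; exact: le_refl.
by rewrite (@lower_extE _ _ _ _ _ _ _ 1) // => -[|[|q]] // _; exact: le_refl.
Qed.

(** This arrow sends a lower set to [top] when it is inhabited and to [bot]
otherwise.  It does not preserve the meet of the final segments, which is
[bot]. *)
Lemma nat_desc_inhabited_arr : exists f : frame_arrow nat_desc sierp,
  forall n, f (tail n) = top.
Proof.
have c : Join (range (fun _ : nat => top : sierp)) = top.
  by apply: le_anti; [exact: le_top | apply: Join_ub; exists 0].
exists (lower_ext nat_desc_total c) => n.
by rewrite (@lower_extE _ _ _ _ _ _ _ n) //= => *; exact: le_refl.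
Qed.

Lemma tails_bot (S : nat_desc) : (forall n, le S (tail n)) -> S = bot.
Proof.
move=> St; apply: le_anti; last exact: bot_le.
by move=> m /(St m.+1) /=; rewrite ltnn.
Qed.

(** * Action of an equivalence on the Sierpinski frame *)

(** [on_obj] and [on_arr] are the action of [T] at the types [frame] and
[frame_arrow], where the coercions to carriers and functions apply. *)
Definition on_obj (T : functor Frm Frm) (A : frame) : frame := T A.

Definition on_arr (T : functor Frm Frm) (A B : frame) (f : frame_arrow A B) :
  frame_arrow (on_obj T A) (on_obj T B) := fmap T (f : @hom Frm A B).

Section Equivalence.
Context (T : functor Frm Frm).

Lemma on_arr_id (A : frame) (x : on_obj T A) : on_arr T (frame_id A) x = x.
Proof. by have := fmap_id T A; rewrite /on_arr /= => ->. Qed.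

Lemma on_arr_comp (A B C : frame) (g : frame_arrow B C) (f : frame_arrow A B)
  (x : on_obj T A) : on_arr T (frame_comp g f) x = on_arr T g (on_arr T f x).
Proof.
by have := fmap_comp T (g : @hom Frm B C) (f : @hom Frm A B);
  rewrite /on_arr /= => ->.
Qed.

Context (HT : is_equivalence T).

Lemma on_arr_full (A B : frame) (h : frame_arrow (on_obj T A) (on_obj T B)) :
  exists f : frame_arrow A B, on_arr T f = h.
Proof. by have [Tfull _ _] := HT; exact: (Tfull A B h). Qed.

Lemma on_arr_faithful (A B : frame) (f g : frame_arrow A B) :
  (forall x, on_arr T f x = on_arr T g x) -> f = g.
Proof.
have [_ Tfaith _] := HT => fg; apply: (Tfaith A B f g).
exact: frame_arrow_eq.
Qed.

Lemma on_obj_ess_surj (B : frame) :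
  exists (A : frame) (e : frame_arrow B (on_obj T A))
    (r : frame_arrow (on_obj T A) B), cancel e r /\ cancel r e.
Proof.
have [A [e [r [er re]]]] := equivalence_ess_surj (B : Frm) HT.
exists A, e, r; split=> x.
  exact: (congr1 (fun h : frame_arrow B B => h x) re).
exact: (congr1 (fun h : frame_arrow (on_obj T A) (on_obj T A) => h x) er).
Qed.

(** The element [u] is moved by the image of a map that identifies [gen] with
[bot], so it is neither [bot] nor [top].  Through the isomorphism of 3 with [T M],
[u] gives an arrow [h] from [M] to 3, and the choice of [u] forces [gen] into the
range of [h].  Thus [h] has a section, and its image under [T] presents [T 3] as a
retract of 3; as [u] avoids [bot] and [top], the retract is the whole of 3. *)
Lemma on_sierp_iso :
  exists (t : on_obj T sierp) (i : frame_arrow (on_obj T sierp) sierp),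
    i t = gen /\ cancel i (classify t).
Proof.
have [u u_move] : exists u, on_arr T (classify (bot : sierp)) u <> u.
  apply/existsNP => fixed.
  have e : classify (bot : sierp) = frame_id sierp.
    by apply: on_arr_faithful => x; rewrite fixed on_arr_id.
  by apply: gen_neq_bot; rewrite -[RHS](classify_gen bot) e.
have [M [e [r [eK rK]]]] := on_obj_ess_surj sierp.
have [h Th] := on_arr_full (frame_comp (classify u) r).
have The : on_arr T h (e gen) = u by rewrite Th frame_compE eK classify_gen.
(* Otherwise [h] takes only the values [bot] and [top], which
   [classify bot] fixes, and then [u] would not be moved. *)
have [c hc] : exists c, h c = gen.
  apply/not_existsP => no; apply: u_move.
  rewrite -The -on_arr_comp; congr (arr_fun (on_arr T _) _).
  apply: frame_arrow_eq => x; rewrite frame_compE.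
  by have := no x; have [->|->|->] := sierpP (h x); rewrite ?arr_bot ?arr_top.
pose i := frame_comp r (on_arr T (classify c)).
have i_inj : injective i.
  apply: (can_inj (g := fun s => on_arr T h (e s))) => x.
  rewrite /i frame_compE rK -on_arr_comp.
  have -> : frame_comp h (classify c) = frame_id sierp.
    by apply: sierp_arr_eq; rewrite frame_compE classify_gen hc.
  by rewrite on_arr_id.
have iu : i u = gen.
  have [iu|//|iu] := sierpP (i u); case: u_move.
    have -> : u = bot by apply: i_inj; rewrite iu arr_bot.
    by rewrite arr_bot.
  have -> : u = top by apply: i_inj; rewrite iu arr_top.
  by rewrite arr_top.
exists u, i; split=> // x; apply: i_inj.
by rewrite arr_classify iu classify_gen_id.
Qed.

(** * The natural bijection *)

Definition lift (t : on_obj T sierp) (A : frame) (x : A) : on_obj T A :=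
  on_arr T (classify x) t.

Lemma lift_nat (t : on_obj T sierp) (A B : frame) (f : frame_arrow A B)
  (x : A) : on_arr T f (lift t x) = lift t (f x).
Proof.
rewrite /lift -on_arr_comp; congr (arr_fun (on_arr T _) _).
by apply: frame_arrow_eq => s; rewrite frame_compE arr_classify.
Qed.

Context (t : on_obj T sierp) (i : frame_arrow (on_obj T sierp) sierp).
Context (it : i t = gen) (iK : cancel i (classify t)).

Lemma lift_inj (A : frame) : injective (@lift t A).
Proof.
move=> x y xy; rewrite -(classify_gen x) -(classify_gen y).
congr (arr_fun _ gen); apply: on_arr_faithful => z.
by rewrite -[z]iK !arr_classify -/(lift t x) xy.
Qed.

Lemma lift_surj (A : frame) (u : on_obj T A) : exists x : A, lift t x = u.
Proof.
have [k Tk] := on_arr_full (frame_comp (classify u) i).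
exists (k gen).
rewrite /lift (_ : classify _ = k); last first.
  by apply: sierp_arr_eq; rewrite classify_gen.
by rewrite Tk frame_compE it classify_gen.
Qed.

Lemma lift_gen : lift t gen = t.
Proof.
rewrite /lift (_ : classify gen = frame_id sierp) ?on_arr_id //.
by apply: frame_arrow_eq => s; exact: classify_gen_id.
Qed.

(** Suppose that [top] is sent to [bot].  Let [S] be the element of [nat_desc]
whose image is the join of the images of the final segments.  Where a point of
[nat_desc] is [top] at [S], its value at each segment has an image below [bot],
so is [top] too: [S] is below all segments, hence is [bot].  The arrow of
[nat_desc_inhabited_arr] is [top] on every segment; its image under [T], which
preserves the join, then shows that [bot] is sent to [bot] as well, against
injectivity. *)
Lemma lift_top_neq_bot : lift t (top : sierp) <> bot.
Proof.
move=> lift_top.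
have [f f_tail] := nat_desc_inhabited_arr.
have [S liftS] := lift_surj (Join (range (fun n => lift t (tail n)))).
have S_bot : S = bot.
  apply: tails_bot => n p /lower_ptP Sp; apply/lower_ptP.
  apply: (@lift_inj sierp); apply: le_anti; rewrite lift_top; last exact: bot_le.
  rewrite -lift_top -Sp -!lift_nat; apply: arr_le.
  by rewrite liftS; apply: Join_ub; exists n.
have : on_arr T f (lift t S) = bot.
  rewrite liftS arr_Join; apply: le_anti; last exact: bot_le.
  apply: Join_le => _ [_ [n _ <-] <-].
  by rewrite lift_nat f_tail lift_top; exact: le_refl.
rewrite lift_nat S_bot arr_bot -lift_top => /(@lift_inj sierp).
exact: sierp_bot_neq_top.
Qed.

Lemma lift_sierp_top : lift t (top : sierp) = top.
Proof.
have := iK (lift t top); have [->|->|->] := sierpP (i (lift t top)).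
- by rewrite arr_bot => /esym /lift_top_neq_bot.
- rewrite classify_gen -{1}lift_gen => /(@lift_inj sierp) /gen_neq_top [].
- by rewrite arr_top.
Qed.

Lemma lift_sierp_bot : lift t (bot : sierp) = bot.
Proof.
have := iK (lift t bot); have [->|->|->] := sierpP (i (lift t bot)).
- by rewrite arr_bot.
- by rewrite classify_gen -{1}lift_gen => /(@lift_inj sierp) /gen_neq_bot [].
- by rewrite arr_top -lift_sierp_top
    => /(@lift_inj sierp) /esym /sierp_bot_neq_top [].
Qed.

Lemma lift_sierp_le (x y : sierp) : le x y -> le (lift t x) (lift t y).
Proof.
move=> /sierp_le[->|->|->].
- by rewrite lift_sierp_bot; exact: bot_le.
- by rewrite lift_sierp_top; exact: le_top.
- exact: le_refl.
Qed.

(** The meet of the two images is the image of some [V]; at each point, [V] has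
the value of [S], by monotonicity on the Sierpinski frame. *)
Lemma lift_lower_le (P : Type) (r : P -> P -> Prop) (S U : lower_frame r) :
  le S U -> le (lift t S) (lift t U).
Proof.
move=> SU; apply/le_meetP.
have [V liftV] := lift_surj (meet (lift t S) (lift t U)).
rewrite -liftV; congr lift; apply: lower_pt_sep => p.
apply: (@lift_inj sierp); rewrite -!lift_nat liftV arr_meet !lift_nat.
by apply/le_meetP; apply: lift_sierp_le; exact: arr_le.
Qed.

Lemma lift_le (A : frame) (x y : A) : le x y -> le (lift t x) (lift t y).
Proof.
move=> /nat_desc_le[h [<- <-]]; rewrite -!lift_nat; apply: arr_le.
by apply: lift_lower_le => m /=; exact: leq_trans.
Qed.

End Equivalence.

Theorem theorem7p5 (T : functor Frm Frm) (HT : is_equivalence T)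
  (L K : Frm) (f g : @hom Frm L K) :
  arrow_le f g -> arrow_le (fmap T f) (fmap T g).
Proof.
move=> fg u.
have [t [i [it iK]]] := on_sierp_iso HT.
have [x <-] := lift_surj HT it u.
rewrite -[fmap T f]/(on_arr T f) -[fmap T g]/(on_arr T g) !lift_nat.
by apply: (lift_le HT it iK); exact: fg.
Qed.
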